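(* Let $\beta\in\mathbb C$ with $|\beta|>1$ and let $\mathcal A\subset\mathbb C$ be finite with $0\in\mathcal A$. Suppose $(\beta,\mathcal A)$ has the OL Property, witnessed by a bounded set $I\subset\mathbb C$ and $\varepsilon>0$, with $0\in I$. Let $D_{\min}>0$, let $K=\sup\{|x|:x\in I\}$, and let $\alpha>0$ satisfy $\alpha(1+|\beta|K+\varepsilon)<\frac{\varepsilon}{2}D_{\min}$. Let $\mathrm{Digit}:(\beta I)^\varepsilon\to\mathcal A$ be any function with $B(V,\varepsilon)\subset I+\mathrm{Digit}(V)$ for all $V\in(\beta I)^\varepsilon$, and let $\mathrm{Trunc}_\alpha:\mathbb C\to\mathbb C$ satisfy $|X-\mathrm{Trunc}_\alpha(X)|<\alpha$ for all $X$. Define $\mathrm{Select_D}(U,D)=\mathrm{Digit}\big(\mathrm{Trunc}_\alpha(U)/\mathrm{Trunc}_\alpha(D)\big)$. Then there exists an integer $\delta\ge1$ such that the following holds: for every input sequence $(n_j)_{j\ge1}$ in $\mathcal A$ with $n_1=\dots=n_\delta=0$ and every input sequence $(d_j)_{j\ge1}$ in $\mathcal A$ with $|D_k|\ge D_{\min}$ and $|\mathrm{Trunc}_\alpha(D_k)|\ge D_{\min}$ for all $k\ge1$, the on-line division algorithm with delay $\delta$ and selection function $\mathrm{Select_D}$ is well defined and its output satisfies $\sum_{j=1}^\infty q_j\beta^{-j}=N/D$, where $N=\sum_{j\ge1}n_j\beta^{-j}$ and $D=\sum_{j\ge1}d_j\beta^{-j}$.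
   Context: $B(x,\varepsilon)$ denotes the open ball of center $x$, radius $\varepsilon$; $T^\varepsilon=\bigcup_{x\in T}B(x,\varepsilon)$, $T+a=\{x+a:x\in T\}$, $\beta T=\{\beta x:x\in T\}$. $(\beta,\mathcal A)$ has the OL Property if there exist $\varepsilon>0$ and a bounded $I\subset\mathbb C$ such that for each $x\in(\beta I)^\varepsilon$ there is $a\in\mathcal A$ with $B(x,\varepsilon)\subset I+a$. On-line division algorithm with delay $\delta$ and selection function $\mathrm{Select_D}$: inputs $(n_j),(d_j)$ as in the claim; $N_k=\sum_{j=1}^k n_j\beta^{-j}$, $D_k=\sum_{j=1}^k d_j\beta^{-j}$, $Q_k=\sum_{j=1}^k q_j\beta^{-j}$. Set $W_0=q_0=Q_0=0$ and for $k\ge1$: $W_k=\beta(W_{k-1}-q_{k-1}D_{k-1+\delta})+(n_{k+\delta}-Q_{k-1}d_{k+\delta})\beta^{-\delta}$ and $q_k=\mathrm{Select_D}(W_k,D_{k+\delta})\in\mathcal A$. The output is $(q_k)_{k\ge1}$. *)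

(* Defs.v *)
(* Stdlib world: concrete reals, with Coquelicot's complex numbers. *)
From Stdlib Require Import Reals.
From Stdlib Require Finite_sets.
From Coquelicot Require Import Coquelicot.

Open Scope C_scope.

Definition subset (S T : C -> Prop) : Prop := forall x, S x -> T x.

(* Coquelicot's [ball] on [C] is the one of the product [R * R], i.e. a square;
   the balls needed here are those of the modulus. *)
Definition Cdisc (x : C) (eps : R) : C -> Prop := fun y => (Cmod (y - x) < eps)%R.

Definition thicken (T : C -> Prop) (eps : R) : C -> Prop :=
  fun y => exists x, T x /\ Cdisc x eps y.

Definition translate (T : C -> Prop) (a : C) : C -> Prop :=
  fun y => exists x, T x /\ y = x + a.

Definition scale (b : C) (T : C -> Prop) : C -> Prop :=
  fun y => exists x, T x /\ y = b * x.

Definition bounded_set (T : C -> Prop) : Prop :=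
  exists M : R, forall x, T x -> (Cmod x <= M)%R.

Definition OL_witness (beta : C) (A I : C -> Prop) (eps : R) : Prop :=
  (0 < eps)%R /\ bounded_set I /\
  forall x, thicken (scale beta I) eps x ->
    exists a, A a /\ subset (Cdisc x eps) (translate I a).

Definition OL_Property (beta : C) (A : C -> Prop) : Prop :=
  exists (eps : R) (I : C -> Prop), OL_witness beta A I eps.

(* Digit sequences are indexed from 1: the value at 0 is never used. *)
Definition partial_value (beta : C) (s : nat -> C) (k : nat) : C :=
  sum_n_m (fun j => s j / beta ^ j) 1 k.

Definition has_value (beta : C) (s : nat -> C) (x : C) : Prop :=
  is_series (fun j => s (S j) / beta ^ (S j)) x.

(* The triple (W_k, q_k, Q_k). *)
Fixpoint division_state (beta : C) (Select : C -> C -> C) (delta : nat)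
    (n d : nat -> C) (k : nat) : C * C * C :=
  match k with
  | O => (RtoC 0, RtoC 0, RtoC 0)
  | S k' =>
      let '(W, q, Q) := division_state beta Select delta n d k' in
      let W' := beta * (W - q * partial_value beta d (k' + delta))
                + (n (k + delta)%nat - Q * d (k + delta)%nat) / beta ^ delta in
      let q' := Select W' (partial_value beta d (k + delta)) in
      (W', q', Q + q' / beta ^ k)
  end.

Definition division_W (beta : C) (Select : C -> C -> C) (delta : nat)
    (n d : nat -> C) (k : nat) : C :=
  fst (fst (division_state beta Select delta n d k)).

Definition division_q (beta : C) (Select : C -> C -> C) (delta : nat)
    (n d : nat -> C) (k : nat) : C :=
  snd (fst (division_state beta Select delta n d k)).

Definition SelectD (Digit Trunc : C -> C) (U D : C) : C :=
  Digit (Trunc U / Trunc D).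

(* [Digit] is represented by a total function of which only the values on
   [dom] are meaningful.  The algorithm is well defined when it never divides
   by zero, never evaluates [Digit] outside [dom], and outputs digits in [A]. *)
Definition division_well_defined (beta : C) (A dom : C -> Prop)
    (Digit Trunc : C -> C) (delta : nat) (n d : nat -> C) : Prop :=
  forall k : nat, (1 <= k)%nat ->
    let W := division_W beta (SelectD Digit Trunc) delta n d k in
    let D := partial_value beta d (k + delta) in
    Trunc D <> 0 /\ dom (Trunc W / Trunc D) /\
    A (division_q beta (SelectD Digit Trunc) delta n d k).

(* Main.v *)
Require Import Defs.
From Stdlib Require Import Reals Lra Lia.
From Stdlib Require Finite_sets.
From Coquelicot Require Import Coquelicot.
Open Scope C_scope.

(* The remainder W_k - q_k D_{k+delta} equals beta^k (N_{k+delta} - Q_k D_{k+delta}),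
   so the algorithm converges as soon as the ratio y_k = W_k / D_{k+delta} - q_k
   stays bounded.  In fact y_k stays in I: by the recurrence W_{k+1} / D_{k+1+delta}
   differs from beta y_k by O(|beta|^-delta), which is below eps/2 for delta large,
   and truncation moves this quotient by less than eps/2.  Hence the truncated
   quotient is in the eps-neighbourhood of beta I, and its eps-disc, which
   contains W_{k+1} / D_{k+1+delta}, lies in I + q_{k+1}. *)

(** * Bounds and convergence for expansions in base [beta] *)

Lemma bounded_set_finite (A : C -> Prop) :
  Finite_sets.Finite C A -> bounded_set A.
Proof.
  induction 1 as [|B HB [M HM] a Ha].
  - exists 0%R. intros x Hx. destruct Hx.
  - exists (Rmax M (Cmod a)). intros x Hx. destruct Hx as [x Hx|x Hx].
    + eapply Rle_trans; [apply HM, Hx|apply Rmax_l].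
    + destruct Hx. apply Rmax_r.
Qed.

Lemma Cmod_gt1_neq_0 (b : C) : (1 < Cmod b)%R -> b <> 0.
Proof. intros Hb. apply Cmod_gt_0. lra. Qed.

Lemma partial_value_S (b : C) (s : nat -> C) (k : nat) :
  partial_value b s (S k) = partial_value b s k + s (S k) / b ^ S k.
Proof. unfold partial_value. rewrite sum_n_Sm by lia. reflexivity. Qed.

Lemma partial_value_0 (b : C) (s : nat -> C) : partial_value b s 0 = 0.
Proof. unfold partial_value. rewrite sum_n_m_zero by lia. reflexivity. Qed.

Lemma partial_value_eq_0 (b : C) (s : nat -> C) (k : nat) :
  (forall j, (1 <= j <= k)%nat -> s j = 0) -> partial_value b s k = 0.
Proof.
  induction k as [|k IH]; intros Hs.
  - apply partial_value_0.
  - rewrite partial_value_S, IH, Hs by (intros; try apply Hs; lia).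
    unfold Cdiv. ring.
Qed.

Lemma Cmod_div_pow_le (b c : C) (M : R) (j : nat) : (1 < Cmod b)%R ->
  (Cmod c <= M)%R -> (Cmod (c / b ^ j) <= M * / Cmod b ^ j)%R.
Proof.
  intros Hb Hc.
  rewrite Cmod_div, Cmod_pow by (apply Cpow_nz, Cmod_gt1_neq_0, Hb).
  apply Rmult_le_compat_r; [|exact Hc].
  apply Rlt_le, Rinv_0_lt_compat, pow_lt. lra.
Qed.

Lemma Cmod_partial_value_le (b : C) (s : nat -> C) (M : R) (k : nat) :
  (1 < Cmod b)%R -> (0 <= M)%R ->
  (forall j, (1 <= j <= k)%nat -> Cmod (s j) <= M)%R ->
  (Cmod (partial_value b s k) <= M / (Cmod b - 1))%R.
Proof.
  intros Hb HM Hs.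
  assert (Hpow : forall j, (0 < / Cmod b ^ j)%R).
  { intros j. apply Rinv_0_lt_compat, pow_lt. lra. }
  (* The factor [1 - / Cmod b ^ k] gives the exact finite geometric sum, so each inductive step
     closes with an equality; the bare bound would not pass through the induction. *)
  assert (H : (Cmod (partial_value b s k)
               <= M / (Cmod b - 1) * (1 - / Cmod b ^ k))%R).
  { induction k as [|k IH].
    - rewrite partial_value_0, Cmod_0. simpl. rewrite Rinv_1. lra.
    - rewrite partial_value_S.
      eapply Rle_trans; [apply Cmod_triangle|].
      eapply Rle_trans.
      { apply Rplus_le_compat; [apply IH; intros; apply Hs; lia|].
        apply (Cmod_div_pow_le b _ M); [exact Hb|apply Hs; lia]. }
      apply Req_le. simpl. field. split; [|split]; try lra.
      apply pow_nonzero. lra. }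
  eapply Rle_trans; [exact H|].
  rewrite <- (Rmult_1_r (M / (Cmod b - 1))) at 2.
  apply Rmult_le_compat_l; [|specialize (Hpow k); lra].
  apply Rle_mult_inv_pos; lra.
Qed.

Lemma ex_has_value (b : C) (s : nat -> C) (M : R) : (1 < Cmod b)%R ->
  (forall j, (1 <= j)%nat -> Cmod (s j) <= M)%R ->
  exists x, has_value b s x.
Proof.
  intros Hb Hs.
  assert (Hq : (0 < / Cmod b < 1)%R).
  { split; [apply Rinv_0_lt_compat; lra|].
    rewrite <- Rinv_1. apply Rinv_lt_contravar; lra. }
  (* The series starts at exponent 1, hence [M / Cmod b] rather than [M] as the factor of the
     geometric majorant. *)
  apply (ex_series_le (K := C_AbsRing) (V := C_CompleteNormedModule) _
           (fun j => scal (M / Cmod b)%R ((/ Cmod b) ^ j)%R)).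
  - intros j. change (Cmod (s (S j) / b ^ S j)
      <= scal (M / Cmod b)%R ((/ Cmod b) ^ j)%R)%R.
    eapply Rle_trans; [apply (Cmod_div_pow_le b _ M); [exact Hb|apply Hs; lia]|].
    apply Req_le. unfold scal; simpl; unfold mult; simpl.
    rewrite pow_inv. field. split; [apply pow_nonzero|]; lra.
  - apply (ex_series_scal (V := R_NormedModule)). apply ex_series_geom. rewrite Rabs_pos_eq; lra.
Qed.

(** * Passing to the limit in partial values *)

Lemma has_value_partial_value (b : C) (s : nat -> C) (x : C) :
  has_value b s x <->
  filterlim (fun k => partial_value b s (S k)) eventually (locally x).
Proof.
  unfold has_value, is_series, partial_value, sum_n.
  split; apply filterlim_ext; intros k;
    rewrite (sum_n_m_S (fun j => s j / b ^ j)); reflexivity.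
Qed.

(** Applied with [m := delta], since [n] and [d] are read [delta] digits ahead of the quotient. *)
Lemma has_value_partial_value_shift (b : C) (s : nat -> C) (x : C) (m : nat) :
  has_value b s x ->
  filterlim (fun k => partial_value b s (S k + m)) eventually (locally x).
Proof.
  intros H. apply has_value_partial_value in H.
  intros P HP. destruct (H P HP) as [N HN].
  exists N. intros k Hk. apply (HN (k + m)%nat). lia.
Qed.

Lemma Cmod_lim_ge (f : nat -> C) (x : C) (m : R) :
  filterlim f eventually (locally x) -> (forall k, m <= Cmod (f k))%R ->
  (m <= Cmod x)%R.
Proof.
  intros Hf Hm.
  assert (H := filterlim_comp _ _ _ f norm _ _ _ Hf (filterlim_norm x)).
  exact (is_lim_seq_le (fun _ => m) (fun k => Cmod (f k)) m (Cmod x)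
           Hm (is_lim_seq_const m) H).
Qed.

(* [filterlim_mult] is about the filters of the absolute ring [C], whose balls
   are discs, whereas [is_series] uses those of the product [R * R]. *)
Lemma filterlim_Cmult (x y : C) :
  filterlim (fun z : C * C => fst z * snd z)
    (filter_prod (locally x) (locally y)) (locally (x * y)).
Proof.
  intros P HP. apply (proj1 (locally_C _ _)) in HP.
  destruct (filterlim_mult (K := C_AbsRing) x y P HP) as [S T HS HT HST].
  exists S T; [apply locally_C, HS|apply locally_C, HT|exact HST].
Qed.

(** * The recurrence and its closed form *)

Lemma division_state_Q (beta : C) (Select : C -> C -> C) (delta : nat)
    (n d : nat -> C) (k : nat) :
  snd (division_state beta Select delta n d k) =
  partial_value beta (division_q beta Select delta n d) k.
Proof.
  induction k as [|k IH].
  - rewrite partial_value_0. reflexivity.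
  - rewrite partial_value_S, <- IH. unfold division_q. simpl.
    destruct (division_state beta Select delta n d k) as [[W q] Q].
    reflexivity.
Qed.

Lemma division_W_S (beta : C) (Select : C -> C -> C) (delta : nat)
    (n d : nat -> C) (k : nat) :
  division_W beta Select delta n d (S k) =
  beta * (division_W beta Select delta n d k
          - division_q beta Select delta n d k * partial_value beta d (k + delta))
  + (n (S (k + delta))
     - partial_value beta (division_q beta Select delta n d) k
       * d (S (k + delta))) / beta ^ delta.
Proof.
  rewrite <- division_state_Q. unfold division_W, division_q. simpl.
  destruct (division_state beta Select delta n d k) as [[W q] Q].
  reflexivity.
Qed.

Lemma division_q_S (beta : C) (Select : C -> C -> C) (delta : nat)
    (n d : nat -> C) (k : nat) :
  division_q beta Select delta n d (S k) =
  Select (division_W beta Select delta n d (S k))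
         (partial_value beta d (S k + delta)).
Proof.
  unfold division_W, division_q. simpl.
  destruct (division_state beta Select delta n d k) as [[W q] Q].
  reflexivity.
Qed.

(** The new digits enter with weight beta^-delta = beta^(k+1) beta^-(k+1+delta), so W_(k+1) is
    beta^(k+1) (N_(k+1+delta) - Q_k D_(k+1+delta)); subtracting q_(k+1) D_(k+1+delta) turns Q_k into
    Q_(k+1). *)
Lemma division_remainder (beta : C) (Select : C -> C -> C) (delta : nat)
    (n d : nat -> C) (k : nat) : beta <> 0 ->
  (forall j, (1 <= j <= delta)%nat -> n j = 0) ->
  division_W beta Select delta n d k
  - division_q beta Select delta n d k * partial_value beta d (k + delta) =
  beta ^ k * (partial_value beta n (k + delta)
              - partial_value beta (division_q beta Select delta n d) k
                * partial_value beta d (k + delta)).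
Proof.
  intros Hb Hn. induction k as [|k IH].
  (* The leading zeros of [n] serve here: W_0 = 0 has to agree with N_delta. *)
  - simpl (0 + delta)%nat.
    rewrite (partial_value_eq_0 beta n delta), partial_value_0 by exact Hn.
    unfold division_W, division_q. simpl. ring.
  - rewrite division_W_S, IH. simpl (S k + delta)%nat.
    rewrite !partial_value_S.
    rewrite !Cpow_S, !Cpow_add_r.
    field. split; [|split]; auto using Cpow_nz.
Qed.

(** * Truncation error and one step of the selection *)

Lemma quotient_perturbation (W U D E : C) (alpha Dmin R0 : R) :
  (0 < Dmin)%R -> (Dmin <= Cmod D)%R -> (Dmin <= Cmod E)%R ->
  (Cmod (W - U) < alpha)%R -> (Cmod (D - E) < alpha)%R ->
  (Cmod (W / D) <= R0)%R ->
  (Cmod (W / D - U / E) * Dmin <= alpha * (1 + R0))%R.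
Proof.
  intros HDmin HD HE HW HDE HR.
  assert (HD0 : D <> 0) by (apply Cmod_gt_0; lra).
  assert (HE0 : E <> 0) by (apply Cmod_gt_0; lra).
  (* Both truncation errors are put over [E], so that only the size of the exact quotient [W / D]
     enters. *)
  replace (W / D - U / E) with ((W - U - W / D * (D - E)) / E)
    by (field; auto).
  rewrite Cmod_div by exact HE0.
  assert (H : (Cmod (W - U - W / D * (D - E)) <= alpha * (1 + R0))%R).
  { unfold Cminus at 1. eapply Rle_trans; [apply Cmod_triangle|].
    rewrite Cmod_opp, Cmod_mult.
    assert (Hp : (Cmod (W / D) * Cmod (D - E) <= R0 * alpha)%R).
    { apply Rmult_le_compat; auto using Cmod_ge_0; lra. }
    lra. }
  assert (Hx := Cmod_ge_0 (W - U - W / D * (D - E))).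
  apply (Rle_trans _ (Cmod (W - U - W / D * (D - E)) / Cmod E * Cmod E)).
  - apply Rmult_le_compat_l; [|exact HE].
    apply Rle_mult_inv_pos; lra.
  - replace (Cmod (W - U - W / D * (D - E)) / Cmod E * Cmod E)%R
      with (Cmod (W - U - W / D * (D - E))) by (field; lra).
    exact H.
Qed.

(** Index-free inductive step: [y] is the previous ratio, [W] and [D] are the new remainder and
    divisor. The bound on [alpha] is [quotient_perturbation] with [R0 := Cmod beta * K + eps]. *)
Lemma SelectD_remainder_in (beta : C) (I : C -> Prop) (eps Dmin K alpha : R)
  (Digit Trunc : C -> C) (y W D : C) :
  (0 < eps)%R -> (0 < Dmin)%R -> (0 < alpha)%R ->
  (forall x, I x -> (Cmod x <= K)%R) ->
  (alpha * (1 + Cmod beta * K + eps) < eps / 2 * Dmin)%R ->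
  (forall V, thicken (scale beta I) eps V ->
     subset (Cdisc V eps) (translate I (Digit V))) ->
  (forall X, (Cmod (X - Trunc X) < alpha)%R) ->
  I y -> (Dmin <= Cmod D)%R -> (Dmin <= Cmod (Trunc D))%R ->
  (Cmod (W - beta * y * D) < eps / 2 * Dmin)%R ->
  thicken (scale beta I) eps (Trunc W / Trunc D) /\
  I (W / D - SelectD Digit Trunc W D).
Proof.
  intros Heps HDmin Halpha HK Hsmall HDigit HTrunc Hy HD HTD HW.
  assert (HD0 : D <> 0) by (apply Cmod_gt_0; lra).
  assert (Hclose : (Cmod (W / D - beta * y) < eps / 2)%R).
  { replace (W / D - beta * y) with ((W - beta * y * D) / D)
      by (field; exact HD0).
    rewrite Cmod_div by exact HD0.
    apply (Rmult_lt_reg_r (Cmod D)); [lra|].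
    replace (Cmod (W - beta * y * D) / Cmod D * Cmod D)%R
      with (Cmod (W - beta * y * D)) by (field; lra).
    eapply Rlt_le_trans; [exact HW|].
    apply Rmult_le_compat_l; lra. }
  assert (Hquot : (Cmod (W / D) <= Cmod beta * K + eps)%R).
  { replace (W / D) with (beta * y + (W / D - beta * y)) by ring.
    eapply Rle_trans; [apply Cmod_triangle|].
    rewrite Cmod_mult.
    assert (Cmod beta * Cmod y <= Cmod beta * K)%R
      by (apply Rmult_le_compat_l; [apply Cmod_ge_0|apply HK, Hy]).
    lra. }
  assert (Htrunc : (Cmod (W / D - Trunc W / Trunc D) < eps / 2)%R).
  { apply (Rmult_lt_reg_r Dmin); [exact HDmin|].
    eapply Rle_lt_trans; [|exact Hsmall].
    replace (1 + Cmod beta * K + eps)%R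
      with (1 + (Cmod beta * K + eps))%R by ring.
    apply quotient_perturbation; auto. }
  assert (Hdom : thicken (scale beta I) eps (Trunc W / Trunc D)).
  { exists (beta * y). split; [exists y; auto|]. unfold Cdisc.
    replace (Trunc W / Trunc D - beta * y)
      with ((W / D - beta * y) + - (W / D - Trunc W / Trunc D)) by ring.
    eapply Rle_lt_trans; [apply Cmod_triangle|]. rewrite Cmod_opp. lra. }
  split; [exact Hdom|].
  (* The digit is chosen from the truncated quotient, but its disc inclusion is used at the exact
     quotient. *)
  destruct (HDigit _ Hdom (W / D)) as [x [Hx Hxe]].
  - unfold Cdisc. lra.
  - unfold SelectD. rewrite Hxe.
    replace (x + _ - _) with x by ring. exact Hx.
Qed.

Theorem theorem16
  (beta : C) (hbeta : (1 < Cmod beta)%R)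
  (A : C -> Prop) (hAfin : Finite_sets.Finite C A) (hA0 : A 0)
  (I : C -> Prop) (eps : R) (hOL : OL_witness beta A I eps) (hI0 : I 0)
  (Dmin : R) (hDmin : (0 < Dmin)%R)
  (K : R) (hK : is_lub (fun r : R => exists x, I x /\ r = Cmod x) K)
  (alpha : R) (halpha : (0 < alpha)%R)
  (halpha_small : (alpha * (1 + Cmod beta * K + eps) < eps / 2 * Dmin)%R)
  (Digit : C -> C)
  (hDigit : forall V, thicken (scale beta I) eps V ->
     A (Digit V) /\ subset (Cdisc V eps) (translate I (Digit V)))
  (Trunc : C -> C) (hTrunc : forall X, (Cmod (X - Trunc X) < alpha)%R) :
  exists delta : nat, (1 <= delta)%nat /\
    forall n d : nat -> C,
      (forall j, (1 <= j)%nat -> A (n j)) ->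
      (forall j, (1 <= j <= delta)%nat -> n j = 0) ->
      (forall j, (1 <= j)%nat -> A (d j)) ->
      (forall k, (1 <= k)%nat ->
         (Dmin <= Cmod (partial_value beta d k))%R /\
         (Dmin <= Cmod (Trunc (partial_value beta d k)))%R) ->
      division_well_defined beta A (thicken (scale beta I) eps)
        Digit Trunc delta n d /\
      exists N D : C,
        has_value beta n N /\ has_value beta d D /\ D <> 0 /\
        has_value beta (division_q beta (SelectD Digit Trunc) delta n d) (N / D).
Proof.
  destruct (bounded_set_finite A hAfin) as [M HM].
  destruct hOL as [Heps _].
  assert (HK : forall x, I x -> (Cmod x <= K)%R).
  { intros x Hx. apply hK. exists x. auto. }
  assert (HM0 : (0 <= M)%R) by (rewrite <- Cmod_0; apply HM, hA0).
  assert (HK0 : (0 <= K)%R) by (rewrite <- Cmod_0; apply HK, hI0).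
  assert (Hb0 : beta <> 0) by (apply Cmod_gt1_neq_0, hbeta).
  assert (HbR : (0 < Cmod beta)%R) by lra.
  (* [c / |beta|^delta] bounds [W_{k+1} - beta y_k D_{k+1+delta}]: the terms come
     from [n], from [Q_k d] and from replacing [D_{k+delta}] by [D_{k+1+delta}]. *)
  set (c := (M + M / (Cmod beta - 1) * M + K * M)%R).
  assert (Htol : (0 < eps / 2 * Dmin)%R) by (apply Rmult_lt_0_compat; lra).
  assert (Hdelta : exists delta, (1 <= delta)%nat /\
            (c * / Cmod beta ^ delta < eps / 2 * Dmin)%R).
  { destruct (Pow_x_infinity (Cmod beta)) with
      (b := (c / (eps / 2 * Dmin) + 1)%R) as [N HN].
    { rewrite Rabs_pos_eq; lra. }
    exists (S N). split; [lia|].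
    specialize (HN (S N) ltac:(lia)).
    assert (Hp := pow_lt (Cmod beta) (S N) HbR).
    rewrite Rabs_pos_eq in HN by lra.
    apply (Rmult_lt_reg_r (Cmod beta ^ S N)); [exact Hp|].
    rewrite Rmult_assoc, Rinv_l, Rmult_1_r by lra.
    apply (Rlt_le_trans _ (eps / 2 * Dmin * (c / (eps / 2 * Dmin) + 1))%R).
    - replace (eps / 2 * Dmin * (c / (eps / 2 * Dmin) + 1))%R
        with (c + eps / 2 * Dmin)%R by (field; lra).
      lra.
    - apply Rmult_le_compat_l; lra. }
  destruct Hdelta as [delta [Hdelta Hc]].
  exists delta. split; [exact Hdelta|].
  intros n d Hn Hn0 Hd HD.
  set (Sel := SelectD Digit Trunc).
  set (W := division_W beta Sel delta n d).
  set (q := division_q beta Sel delta n d).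
  set (Dk := partial_value beta d).
  assert (HDk : forall k, (Dmin <= Cmod (Dk (k + delta)%nat))%R)
    by (intros k; apply HD; lia).
  assert (HDk0 : forall k, Dk (k + delta)%nat <> 0).
  { intros k. apply Cmod_gt_0. specialize (HDk k). lra. }
  (* Membership of all earlier digits in [A] is carried along because the next step needs a bound on
     Q_k. The range starts at 1, as no selection occurs at index 0. *)
  assert (Hinv : forall k,
    I (W k / Dk (k + delta)%nat - q k) /\
    forall j, (1 <= j <= k)%nat ->
      thicken (scale beta I) eps (Trunc (W j) / Trunc (Dk (j + delta)%nat)) /\
      A (q j)).
  { induction k as [|k [Hy Hj]].
    - split; [|intros; lia].
      unfold W, q, division_W, division_q; simpl.
      replace (0 / Dk delta - 0) with (RtoC 0); [exact hI0|].
      unfold Cdiv. ring.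
    - set (y := W k / Dk (k + delta)%nat - q k) in Hy.
      (* Here beta (W_k - q_k D_(k+delta)) = beta y D_(k+delta); replacing the divisor by
         D_(k+1+delta) produces the last term. *)
      assert (HW : W (S k) - beta * y * Dk (S k + delta)%nat
        = (n (S (k + delta)) - partial_value beta q k * d (S (k + delta)))
            / beta ^ delta
          - y * d (S (k + delta)) / beta ^ k / beta ^ delta).
      { unfold W, Dk. rewrite division_W_S. fold W q Dk.
        simpl (S k + delta)%nat. unfold Dk at 2. rewrite partial_value_S.
        fold Dk. unfold y. rewrite Cpow_S, Cpow_add_r. field.
        split; [|split; [|split]]; auto using Cpow_nz. }
      assert (Herr : (Cmod (W (S k) - beta * y * Dk (S k + delta)%nat)
                      < eps / 2 * Dmin)%R).
      { rewrite HW. eapply Rle_lt_trans; [|exact Hc].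
        match goal with |- (Cmod ?t <= _)%R =>
          replace t with
           ((n (S (k + delta)) - partial_value beta q k * d (S (k + delta))
             - y * (d (S (k + delta)) / beta ^ k)) / beta ^ delta)
           by (unfold Cdiv; ring) end.
        apply Cmod_div_pow_le; [exact hbeta|].
        unfold c. unfold Cminus.
        eapply Rle_trans; [apply Cmod_triangle|].
        rewrite Cmod_opp, Cmod_mult.
        apply Rplus_le_compat.
        - eapply Rle_trans; [apply Cmod_triangle|].
          rewrite Cmod_opp, Cmod_mult.
          apply Rplus_le_compat; [apply HM, Hn; lia|].
          apply Rmult_le_compat; try apply Cmod_ge_0; [|apply HM, Hd; lia].
          apply Cmod_partial_value_le; auto.
          intros j Hjk. apply HM, Hj, Hjk.
        - apply Rmult_le_compat; try apply Cmod_ge_0; [apply HK, Hy|].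
          eapply Rle_trans;
            [apply (Cmod_div_pow_le _ _ M);
              [exact hbeta|apply HM, Hd; lia]|].
          (* Dropping the factor |beta|^-k <= 1 makes the bound, hence the delay, independent of
             k. *)
          rewrite <- (Rmult_1_r M) at 2.
          apply Rmult_le_compat_l; [exact HM0|].
          rewrite <- Rinv_1. apply Rinv_le_contravar; [lra|].
          apply pow_R1_Rle. lra. }
      destruct (SelectD_remainder_in beta I eps Dmin K alpha Digit Trunc y
                  (W (S k)) (Dk (S k + delta)%nat)) as [Hdom HI]; auto.
      { intros V HV. apply hDigit, HV. }
      { apply HD. lia. }
      assert (Hq : q (S k) = Sel (W (S k)) (Dk (S k + delta)%nat))
        by apply division_q_S.
      split; [rewrite Hq; exact HI|].
      intros j Hjk. destruct (Nat.eq_dec j (S k)) as [->|Hne].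
      + split; [exact Hdom|]. rewrite Hq. apply hDigit, Hdom.
      + apply Hj. lia. }
  assert (Hqj : forall j, (1 <= j)%nat ->
    thicken (scale beta I) eps (Trunc (W j) / Trunc (Dk (j + delta)%nat)) /\
    A (q j)) by (intros j Hj; apply (Hinv j); lia).
  split.
  { intros k Hk. split; [|apply Hqj, Hk].
    apply Cmod_gt_0. destruct (HD (k + delta)%nat) as [_ H]; [lia|lra]. }
  destruct (ex_has_value beta n M hbeta) as [N HN];
    [intros; apply HM, Hn; assumption|].
  destruct (ex_has_value beta d M hbeta) as [D HDv];
    [intros; apply HM, Hd; assumption|].
  (* Bounded digits already make the output converge; its value is identified below. *)
  destruct (ex_has_value beta q M hbeta) as [Q HQ];
    [intros; apply HM, Hqj; assumption|].
  assert (LN := has_value_partial_value_shift beta n N delta HN).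
  assert (LD := has_value_partial_value_shift beta d D delta HDv).
  assert (LQ := proj1 (has_value_partial_value beta q Q) HQ).
  assert (HD0 : D <> 0).
  { apply Cmod_gt_0. apply (Rlt_le_trans _ Dmin); [exact hDmin|].
    apply (Cmod_lim_ge _ D Dmin LD). intros k. apply (HDk (S k)). }
  exists N, D. split; [exact HN|]. split; [exact HDv|]. split; [exact HD0|].
  assert (Hrem : forall k,
    partial_value beta n (k + delta)
    - partial_value beta q k * Dk (k + delta)%nat
    = (W k / Dk (k + delta)%nat - q k) * Dk (k + delta)%nat / beta ^ k).
  { intros k.
    replace ((W k / Dk (k + delta)%nat - q k) * Dk (k + delta)%nat)
      with (W k - q k * Dk (k + delta)%nat) by (field; apply HDk0).
    unfold W, q, Dk. rewrite division_remainder by assumption.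
    fold q. field. apply Cpow_nz, Hb0. }
  (* The left side of [Hrem] tends to [N - Q * D] by continuity, and to 0 since its modulus is at
     most [c'] times |beta|^-k: [K] bounds the ratio in [I], and M / (|beta| - 1) the partial
     divisor. *)
  assert (HNQ : N - Q * D = 0).
  { assert (L1 : filterlim (fun k => partial_value beta n (S k + delta)
        - partial_value beta q (S k) * Dk (S k + delta)%nat)
        eventually (locally (N - Q * D))).
    { apply (filterlim_comp_2 (G := locally N) (H := locally (opp (Q * D)))
               (fun k => partial_value beta n (S k + delta))
               (fun k => opp (partial_value beta q (S k) * Dk (S k + delta)%nat))
               plus); [exact LN| |exact (filterlim_plus N (opp (Q * D)))].
      eapply filterlim_comp; [|exact (filterlim_opp (Q * D))].
      exact (filterlim_comp_2 _ _ Cmult LQ LD (filterlim_Cmult Q D)). }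
    refine (filterlim_locally_unique _ _ _ L1 _).
    apply (filterlim_norm_zero (V := C_NormedModule)).
    set (c' := (K * (M / (Cmod beta - 1)))%R).
    change (is_lim_seq (fun k => Cmod (partial_value beta n (S k + delta)
      - partial_value beta q (S k) * Dk (S k + delta)%nat)) 0%R).
    apply (is_lim_seq_le_le (fun _ => 0%R) _
             (fun k => c' * (/ Cmod beta) ^ S k)%R).
    - intros k. split; [apply Cmod_ge_0|].
      rewrite Hrem, pow_inv.
      apply Cmod_div_pow_le; [exact hbeta|]. rewrite Cmod_mult.
      apply Rmult_le_compat; try apply Cmod_ge_0; [apply HK, Hinv|].
      apply Cmod_partial_value_le; auto. intros j Hj. apply HM, Hd. lia.
    - apply is_lim_seq_const.
    - rewrite <- (Rmult_0_r c').
      apply (is_lim_seq_scal_l (fun k => (/ Cmod beta) ^ S k)%R c' 0%R).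
      apply (is_lim_seq_incr_1 (fun k => (/ Cmod beta) ^ k)%R).
      apply is_lim_seq_geom.
      assert (H0 : (0 < / Cmod beta)%R) by (apply Rinv_0_lt_compat; lra).
      rewrite Rabs_pos_eq by lra.
      rewrite <- Rinv_1. apply Rinv_lt_contravar; lra. }
  replace (N / D) with Q; [exact HQ|].
  replace N with (N - Q * D + Q * D) by ring. rewrite HNQ. field. exact HD0.
Qed.
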